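(* For every sufficiently large integer $n$, setting $p=\lceil\log_2(2n)\rceil$ and $w=\lceil\log_{3/2}p\rceil$, the graph $G_{w,p}$ is defined and satisfies $|V(G_{w,p})|\leq 20n$ and $|E(G_{w,p})|\leq 20n(\log_2 n)(\log_{3/2}\log_2 n)+O(n\log n)$ (with an absolute implied constant). Moreover, $G_{w,p}$ contains every $n$-vertex tree.
   Context: For integers $w,p\geq0$ define $\alpha(w,p)=\frac{1}{1+(2/3)^{w}}\Big(\frac{2+(2/3)^{w}}{1+(2/3)^{w}}\Big)^{p-1}$, $\beta(w)=3(\frac{3}{2})^{w}$ and $\delta(w)=(2+(\frac{2}{3})^{w})\beta(w)$. Let $p_w$ be the smallest integer such that $\alpha(w,p_w+1)\geq\beta(w)$. For $p\geq p_w$ define $G_{w,p}$ recursively: $G_{w,p_w}$ is the complete graph $K_{\lceil\delta(w)\rceil}$, and for $p\geq p_w+1$, $G_{w,p}$ is obtained from a complete graph $K_{w+1}$ and two disjoint copies of $G_{w,p-1}$ by adding all edges between the vertices of $K_{w+1}$ and the vertices of the two copies. A graph $U$ contains a graph $H$ if some subgraph of $U$ is isomorphic to $H$. *)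

(* Defs.v *)
From mathcomp Require Import all_boot all_order all_algebra.
From mathcomp Require Import reals exp.
From mathcomp Require Import lra zify.

Set Implicit Arguments.
Unset Strict Implicit.
Unset Printing Implicit Defensive.

Import Order.TTheory GRing.Theory Num.Theory.

(** * Finite simple graphs *)

Record sgraph := SGraph {
  vert :> finType;
  adj : rel vert;
  adj_sym : symmetric adj;
  adj_irr : irreflexive adj }.

Definition edges (G : sgraph) : {set {set G}} :=
  [set e : {set G} | [exists x, exists y, adj x y && (e == [set x; y])]].

Lemma complete_sym n : symmetric (fun x y : 'I_n => x != y).
Proof. by move=> x y; rewrite eq_sym. Qed.

Lemma complete_irr n : irreflexive (fun x y : 'I_n => x != y).
Proof. by move=> x; rewrite eqxx. Qed.

Definition complete (n : nat) : sgraph :=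
  SGraph (@complete_sym n) (@complete_irr n).

Section Operations.
Variables G H : sgraph.

Definition disjoint_union_adj : rel (G + H)%type := fun u v =>
  match u, v with
  | inl x, inl y => adj x y
  | inr x, inr y => adj x y
  | _, _ => false
  end.

Lemma disjoint_union_sym : symmetric disjoint_union_adj.
Proof. by case=> x [y|y] //=; rewrite adj_sym. Qed.

Lemma disjoint_union_irr : irreflexive disjoint_union_adj.
Proof. by case=> x /=; rewrite adj_irr. Qed.

Definition disjoint_union : sgraph :=
  SGraph disjoint_union_sym disjoint_union_irr.

Definition join_adj : rel (G + H)%type := fun u v =>
  match u, v with
  | inl x, inl y => adj x y
  | inr x, inr y => adj x y
  | _, _ => true
  end.

Lemma join_sym : symmetric join_adj.
Proof. by case=> x [y|y] //=; rewrite adj_sym. Qed.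

Lemma join_irr : irreflexive join_adj.
Proof. by case=> x /=; rewrite adj_irr. Qed.

Definition join : sgraph := SGraph join_sym join_irr.

End Operations.

Record subgraph (U : sgraph) := Subgraph {
  sub_vert : {set U};
  sub_adj : rel U;
  sub_adj_sym : symmetric sub_adj;
  sub_adjP : forall x y, sub_adj x y ->
    [/\ x \in sub_vert, y \in sub_vert & adj x y] }.

Section GraphOfSubgraph.
Variables (U : sgraph) (K : subgraph U).

Definition graph_of_adj : rel {x : U | x \in sub_vert K} :=
  fun x y => sub_adj K (val x) (val y).

Lemma graph_of_sym : symmetric graph_of_adj.
Proof. by move=> x y; exact: sub_adj_sym. Qed.

Lemma graph_of_irr : irreflexive graph_of_adj.
Proof.
by move=> x; apply/negP => /sub_adjP[_ _]; rewrite adj_irr.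
Qed.

Definition graph_of : sgraph := SGraph graph_of_sym graph_of_irr.

End GraphOfSubgraph.

Definition isomorphic (G H : sgraph) : Prop :=
  exists f : G -> H, bijective f /\ forall x y, adj (f x) (f y) = adj x y.

Definition contains (U H : sgraph) : Prop :=
  exists K : subgraph U, isomorphic (graph_of K) H.

Definition connected (G : sgraph) : Prop :=
  0 < #|G| /\ forall x y : G, connect (@adj G) x y.

(* The bound 2 < size c is needed because mathcomp's [ucycle] also accepts the
   empty sequence and, for adjacent x and y, the sequence [:: x; y]. *)
Definition acyclic (G : sgraph) : Prop :=
  ~ exists c : seq G, 2 < size c /\ ucycle (@adj G) c.

Definition is_tree (G : sgraph) : Prop := connected G /\ acyclic G.

(** * The graphs G_{w,p} *)

Local Open Scope ring_scope.

Definition alpha (w p : nat) : rat :=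
  (1 + (2 / 3) ^+ w)^-1
  * ((2 + (2 / 3) ^+ w) / (1 + (2 / 3) ^+ w)) ^ (p%:Z - 1).

Definition beta (w : nat) : rat := 3 * (3 / 2) ^+ w.

Definition delta (w : nat) : rat := (2 + (2 / 3) ^+ w) * beta w.

Lemma pw_exists (w : nat) : exists q : nat, beta w <= alpha w q.+1.
Proof.
exists (w + 5)%N; rewrite /alpha /beta.
have -> : (w + 5).+1%:Z - 1 = (w + 5)%N by lia.
rewrite -exprnP.
set x : rat := (2 / 3) ^+ w.
have x0 : 0 < x by rewrite exprn_gt0.
have x1 : x <= 1 by rewrite exprn_ile1.
have y0 : 0 < 1 + x by lra.
have hr : 3 / 2 <= (2 + x) / (1 + x) by rewrite ler_pdivlMr //; lra.
have hpow : (3 / 2 : rat) ^+ (w + 5) <= ((2 + x) / (1 + x)) ^+ (w + 5).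
  by apply: lerXn2r; rewrite // nnegrE ?divr_ge0 //; lra.
rewrite [leRHS]mulrC ler_pdivlMr //; apply: le_trans hpow.
rewrite exprD.
have z0 : 0 < (3 / 2 : rat) ^+ w by rewrite exprn_gt0.
set z := (3 / 2) ^+ w in z0 *.
have -> : (3 / 2 : rat) ^+ 5 = 243 / 32 by [].
nra.
Qed.

Definition pw (w : nat) : nat := ex_minn (pw_exists w).

Fixpoint Gstep (w k : nat) : sgraph :=
  if k is k'.+1 then
    join (complete w.+1) (disjoint_union (Gstep w k') (Gstep w k'))
  else complete `|Num.ceil (delta w)|%N.

(* Only meaningful for p >= pw w; below, the truncated subtraction returns the
   base graph. *)
Definition Gwp (w p : nat) : sgraph := Gstep w (p - pw w).

Lemma Gwp_base (w : nat) : Gwp w (pw w) = complete `|Num.ceil (delta w)|%N.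
Proof. by rewrite /Gwp subnn. Qed.

Lemma Gwp_step (w p : nat) : (pw w < p)%N ->
  Gwp w p =
  join (complete w.+1) (disjoint_union (Gwp w p.-1) (Gwp w p.-1)).
Proof.
by case: p => // p lt_p; rewrite /Gwp subSn.
Qed.

(** * The parameters *)

Definition logb (R : realType) (b x : R) : R := ln x / ln b.

Definition p_of (R : realType) (n : nat) : nat :=
  `|Num.ceil (logb (2 : R) (2 * n%:R))|%N.

Definition w_of (R : realType) (n : nat) : nat :=
  `|Num.ceil (logb (3 / 2 : R) (p_of R n)%:R)|%N.

(* Main.v *)
(** A single vertex v splits off from a forest a set C of size between s and
    2s - 1 that has no neighbours outside C and v. With s about a third of the
    imbalance |A| - |B|, moving C from A to B halves the imbalance. After w + 1
    such steps the forest minus w + 1 vertices falls into two non-adjacent parts,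
    each of proportion at most (1 + x)/(2 + x), where x = (2/3)^w. Embedding the
    removed vertices in K_(w+1) and the parts in the two copies, one finds by
    induction that G_(w,p) contains all forests with at most
    ((2 + x)/(1 + x))^p vertices, which is at least 2^p / 2 >= n once x <= 1/p.
    The base graph is big enough for the forests that are too small for the
    splitting argument. *)

Require Import Defs.
From mathcomp Require Import all_boot all_order all_algebra.
From mathcomp Require Import reals exp.
From mathcomp Require Import ring lra zify.

Set Implicit Arguments.
Unset Strict Implicit.
Unset Printing Implicit Defensive.

Import Order.TTheory GRing.Theory Num.Theory.

(** * Splitting a forest at one vertex *)

Definition adj_in (G : sgraph) (C : {set G}) : rel G :=
  fun x y => [&& adj x y, x \in C & y \in C].

(** If [a] and [b] differed, a duplicate-free path between them inside [C] would close up through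
    [v] to a cycle on at least three vertices. *)
Lemma acyclic_neighbour_uniq (T : sgraph) (C : {set T}) (v a b : T) :
  acyclic T -> v \notin C -> a \in C -> adj v a -> adj v b ->
  connect (adj_in C) a b -> a = b.
Proof.
move=> acT vC aC va vb /connectP[q q_path b_last].
case/shortenP: q_path b_last => q' q'_path q'_uniq _ b_last.
apply/eqP; apply: contraT => ab; case: acT; exists (v :: a :: q').
case: q' q'_path q'_uniq b_last => [|c q'] q'_path q'_uniq b_last.
  by rewrite b_last eqxx in ab.
have sub_q : all (mem C) (c :: q').
  by elim: (c :: q') (a) q'_path => //= y r IH z /andP[/and3P[_ _ ->]] /IH.
have [/andP[/and3P[ac _ _] path_q] q_vb] := (q'_path, b_last).
have vq : v \notin a :: c :: q'.
  by rewrite inE negb_or (memPnC vC) //; apply: contra vC => /(allP sub_q).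
split=> //; apply/andP; split; last by rewrite cons_uniq vq.
rewrite /= va ac rcons_path -[last _ _]b_last adj_sym vb andbT.
by apply: sub_path path_q => y z /and3P[].
Qed.

(** [C] is a union of components of [A] minus [v]. The two are packed into a pair so that a least
    one can be chosen over a finite type. *)
Definition splits (T : sgraph) (A : {set T}) (vC : T * {set T}) : bool :=
  [&& vC.1 \in A, vC.2 \subset A :\ vC.1 &
      [forall x in vC.2, forall y in A :\ vC.1, adj x y ==> (y \in vC.2)]].

Lemma splitsP (T : sgraph) (A C : {set T}) (v : T) :
  reflect [/\ v \in A, C \subset A :\ v &
    forall x y, x \in C -> y \in A -> y != v -> adj x y -> y \in C]
  (splits A (v, C)).
Proof.
apply: (iffP and3P) => /= -[vA CA clC]; split=> //.
  move=> x y xC yA yv xy; apply: (implyP (forall_inP (forall_inP clC x xC) y _)) => //.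
  by rewrite !inE yv.
apply/forall_inP => x xC; apply/forall_inP => y; rewrite !inE => /andP[yv yA].
by apply/implyP; exact: clC.
Qed.

(* Among the splitting pairs with [s <= #|C|] take one with [#|C|] least. If
   [2 * s <= #|C|] then C is connected, so v has a single neighbour u in C, and
   (u, C :\ u) is a smaller pair. *)
Lemma acyclic_split (T : sgraph) (A : {set T}) (s : nat) :
  acyclic T -> 0 < s -> s < #|A| ->
  exists v C, splits A (v, C) /\ s <= #|C| < 2 * s.
Proof.
move=> acT s_gt0 sA.
have /card_gt0P[v0 v0A] : 0 < #|A| by lia.
pose P (q : T * {set T}) := splits A q && (s <= #|q.2|).
have P0 : P (v0, A :\ v0).
  apply/andP; split=> /=; last by move: (cardsD1 v0 A); rewrite v0A; lia.
  by apply/splitsP; split=> // x y _ yA yv _; rewrite !inE yv.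
case: (arg_minnP (fun q : T * {set T} => #|q.2|) P0) => -[v C].
move=> /andP[spl /= sC] Cmin; exists v, C; split=> //; rewrite sC /=.
have {}Cmin v' C' : splits A (v', C') -> s <= #|C'| -> #|C| <= #|C'|.
  by move=> spl' sC'; apply: (Cmin (v', C')); rewrite /P spl'.
rewrite ltnNge; apply/negP => C_large.
have [vA CA clC] := splitsP _ _ _ spl.
have CA' x : x \in C -> x \in A by move/(subsetP CA); rewrite !inE => /andP[].
have vC : v \notin C by apply/negP => /(subsetP CA); rewrite !inE eqxx.
(* If [v] has no neighbour in [C], any [u] in [C] serves. *)
have [u uC u_nb] : exists2 u, u \in C & forall x, x \in C -> adj v x -> adj v u.
  case: (pickP [pred x in C | adj v x]) => [u /andP[uC vu]|no_nb].
    by exists u.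
  have /card_gt0P[u uC] : 0 < #|C| by lia.
  by exists u => // x xC vx; move: (no_nb x) => /=; rewrite xC vx.
pose C1 := [set x in C | connect (adj_in C) u x].
have uC1 : u \in C1 by rewrite inE uC connect0.
have C1C : C1 \subset C by apply/subsetP => x; rewrite inE => /andP[].
have sym_in : connect_sym (adj_in C).
  by apply: sym_connect_sym => x y; rewrite /adj_in adj_sym [(x \in C) && _]andbC.
have C1_spl : splits A (v, C1).
  apply/splitsP; split=> // [|x y]; first exact: subset_trans CA.
  rewrite !inE => /andP[xC ux] yA yv xy.
  have yC := clC x y xC yA yv xy; rewrite yC; apply: connect_trans ux _.
  by apply: connect1; rewrite /adj_in xy xC.
have C2_spl : splits A (v, C :\: C1).
  apply/splitsP; split=> // [|x y].
    by apply: subset_trans CA; exact: subsetDl.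
  rewrite !inE => /andP[xC1 xC] yA yv xy; rewrite xC /= in xC1.
  have yC := clC x y xC yA yv xy; rewrite yC andbT /=.
  apply: contra xC1 => uy; apply: connect_trans uy _.
  by apply: connect1; rewrite /adj_in adj_sym xy yC.
have C_sum := cardsID C1 C; rewrite (setIidPr C1C) in C_sum.
have C1_gt0 : 0 < #|C1| by apply/card_gt0P; exists u.
(* Otherwise [C1] and [C :\: C1] both give smaller splitting pairs, so each has fewer than [s]
   elements and [C] fewer than [2 * s]. *)
have C_C1 : C1 = C.
  apply/eqP; rewrite eqEcard C1C leqNgt; apply/negP => C1_lt.
  have c1 : #|C1| < s.
    by rewrite ltnNge; apply/negP => /(Cmin v C1 C1_spl); rewrite leqNgt C1_lt.
  have c2 : #|C :\: C1| < s.
    rewrite ltnNge; apply/negP => /(Cmin v _ C2_spl).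
    by rewrite leqNgt -C_sum -{1}[#|C :\: C1|]add0n ltn_add2r C1_gt0.
  by clear -c1 c2 C_sum C_large; lia.
suff spl_u : splits A (u, C :\ u).
  have cu := cardsD1 u C; rewrite uC in cu.
  have su : s <= #|C :\ u| by clear -cu C_large s_gt0; lia.
  by have := Cmin _ _ spl_u su; clear -cu; lia.
apply/splitsP; split=> [||x y]; first exact: CA'.
  by rewrite setSD //; apply/subsetP.
rewrite !inE => /andP[xu xC] yA yu xy; rewrite yu /=.
(* An edge from [C :\ u] to a vertex of [A] outside [C] could only end in [v], which has no
   neighbour in [C] other than [u]. *)
have [yv|] := eqVneq y v; last by move=> yv; exact: clC xy.
have vx : adj v x by rewrite -yv adj_sym.
have ux : connect (adj_in C) u x by move: xC; rewrite -{1}C_C1 inE => /andP[].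
have := acyclic_neighbour_uniq acT vC uC (u_nb x xC vx) vx ux.
by move=> ux'; rewrite ux' eqxx in xu.
Qed.

(** * Balanced separators of forests *)

Definition separated (T : sgraph) (U A B : {set T}) :=
  [/\ A \subset U, B \subset U, [disjoint A & B] &
      forall x y, x \in A -> y \in B -> ~~ adj x y].

Lemma separatedC (T : sgraph) (U A B : {set T}) :
  separated U A B -> separated U B A.
Proof.
move=> [AU BU AB nadj]; split=> // [|x y xB yA]; first by rewrite disjoint_sym.
by rewrite adj_sym nadj.
Qed.

(** Each induction step adds one vertex to the separator and halves the imbalance. An imbalance of
    at most 2 has integer third 0 and allows no further step, whence the second alternative. *)
Lemma acyclic_balanced_separator (T : sgraph) (U : {set T}) (k : nat) :
  acyclic T -> exists A B, [/\ separated U A B, #|U :\: (A :|: B)| <= k,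
    #|B| <= #|A| & 2 ^ k * (#|A| - #|B|) <= #|U| \/ #|A| - #|B| <= 2].
Proof.
move=> acT; elim: k => [|k [A [B [sepAB Sk BA bal]]]].
  exists U, set0; rewrite setU0 setDv !cards0 subn0 expn0 mul1n; split; auto.
  split=> //; [exact: sub0set | by rewrite disjoints_subset setC0 subsetT|].
  by move=> x y _; rewrite inE.
have [small|large] := leqP (#|A| - #|B|) 2.
  by exists A, B; split=> //; [lia | right].
(* With d the imbalance and c the size of [C], the new signed imbalance is d - 2c - 1. From 3s <= d
   <= 3s + 2 and s <= c <= 2s - 1 its absolute value is at most d/2. *)
pose s := (#|A| - #|B|) %/ 3.
have [||v [C [/splitsP[vA CA clC] sC]]] := @acyclic_split T A s acT; [lia | lia |].
have [AU BU AB nadj] := sepAB.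
have CA' : C \subset A by apply: subset_trans CA _; exact: subsetDl.
pose A' := (A :\ v) :\: C; pose B' := B :|: C.
have cA' : #|A| = (#|A'| + #|C|).+1.
  by rewrite (cardsD1 v A) vA -(cardsID C (A :\ v)) (setIidPr CA) add1n addnC.
have cB' : #|B'| = #|B| + #|C|.
  rewrite cardsU disjoint_setI0 ?cards0 ?subn0 //.
  by rewrite disjoint_sym; apply: disjointWl AB.
have sep' : separated U A' B'.
  split.
  - by apply: subset_trans AU; apply: subset_trans (subsetDl _ _) (subsetDl _ _).
  - by rewrite subUset BU (subset_trans CA').
  - rewrite -setI_eq0; apply/eqP/setP => x; rewrite !inE.
    case: (boolP (x \in C)) => //= _; rewrite orbF.
    by case: (boolP (x \in A)) => xA; rewrite ?andbF // (disjointFr AB xA) andbF.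
  - move=> x y; rewrite !inE => /and3P[xC xv xA] /orP[yB|yC]; first exact: nadj.
    by apply/negP => xy; case/negP: xC; apply: (clC y x); rewrite // adj_sym.
have Sk' : #|U :\: (A' :|: B')| <= k.+1.
  apply: (@leq_trans #|v |: (U :\: (A :|: B))|).
    apply: subset_leq_card; apply/subsetP => x; rewrite !inE !negb_or.
    by case: (x == v); case: (x \in C); case: (x \in B); case: (x \in A).
  by rewrite cardsU1; case: (v \notin _) => /=; lia.
have halve d : 2 * d <= #|A| - #|B| -> 2 ^ k.+1 * d <= #|U| \/ d <= 2.
  move=> dd; case: bal => bal; last by right; lia.
  by left; apply: leq_trans bal; rewrite expnSr -mulnA leq_pmul2l ?expn_gt0.
(* The imbalance may change sign, and then the parts trade places. *)
have [le|lt] := leqP #|B'| #|A'|.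
  by exists A', B'; split=> //; apply: halve; lia.
exists B', A'; split; [exact: separatedC | by rewrite setUC | exact: ltnW |].
by apply: halve; lia.
Qed.

(** * Embeddings of vertex sets *)

(** Only the values of [f] on [A] matter, so parts of a forest stay subsets of [T] and never become
    graphs of their own. *)
Definition embeds (T U : sgraph) (A : {set T}) : Prop :=
  exists f : T -> U, {in A &, injective f} /\
    {in A &, forall x y, adj x y -> adj (f x) (f y)}.

(** The map is total on [T] and needs a default value, hence a nonempty target even when [A] is
    empty. *)
Lemma embeds_complete (T : sgraph) (A : {set T}) (n : nat) :
  0 < n -> #|A| <= n -> embeds (complete n) A.
Proof.
case: n => // n _ An.
have inj : {in A &, injective (fun x => inord (index x (enum A)) : 'I_n.+1)}.
  move=> x y xA yA /(congr1 val) /=.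
  have idx z : z \in A -> index z (enum A) < n.+1.
    by move=> zA; apply: leq_trans An; rewrite cardE index_mem mem_enum.
  rewrite !inordK ?idx // => /(congr1 (nth x (enum A))).
  by rewrite !nth_index ?mem_enum.
exists (fun x => inord (index x (enum A)) : 'I_n.+1); split=> //.
move=> x y xA yA xy; apply/eqP => /(inj x y xA yA) eq_xy.
by rewrite eq_xy adj_irr in xy.
Qed.

Lemma embeds_join (T G H : sgraph) (U A : {set T}) :
  embeds G (U :\: A) -> embeds H A -> embeds (join G H) U.
Proof.
move=> [g [g_inj g_adj]] [h [h_inj h_adj]].
exists (fun x => if x \in A then inr (h x) else inl (g x)); split=> x y xU yU;
  case: (boolP (x \in A)) => xA; case: (boolP (y \in A)) => yA //=.
- by case=> /h_inj; apply.
- by case=> /g_inj; rewrite !inE xA yA; apply.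
- exact: h_adj.
- by apply: g_adj; rewrite !inE ?xA ?yA.
Qed.

Lemma embeds_disjoint_union (T G H : sgraph) (U A B : {set T}) :
  separated U A B -> embeds G A -> embeds H B ->
  embeds (disjoint_union G H) (A :|: B).
Proof.
move=> [_ _ _ nadj] [g [g_inj g_adj]] [h [h_inj h_adj]].
exists (fun x => if x \in A then inl (g x) else inr (h x)).
split=> x y; rewrite !inE;
  case: (boolP (x \in A)) => xA; case: (boolP (y \in A)) => yA //= xB yB.
- by case=> /g_inj; apply.
- by case=> /h_inj; apply.
- exact: g_adj.
- by move=> xy; case/negP: (nadj x y xA yB).
- by move=> xy; case/negP: (nadj y x yA xB); rewrite adj_sym.
- exact: h_adj.
Qed.

Lemma embeds_contains (T U : sgraph) : embeds U [set: T] -> contains U T.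
Proof.
move=> [f [f_inj f_adj]].
have inj_f : injective f by move=> x y; apply: f_inj; rewrite inE.
(* [f] may send non-adjacent vertices to adjacent ones, so the subgraph keeps only the images of
   edges of [T]. *)
pose e : rel U := fun u v => [exists x, exists y, [&& adj x y, u == f x & v == f y]].
have eP x y : e (f x) (f y) = adj x y.
  apply/existsP/idP => [[x' /existsP[y' /and3P[xy /eqP/inj_f-> /eqP/inj_f->]]]|] //.
  by move=> xy; exists x; apply/existsP; exists y; rewrite xy !eqxx.
have e_sym : symmetric e.
  have half u v : e u v -> e v u.
    case/existsP=> x /existsP[y /and3P[xy /eqP-> /eqP->]].
    by rewrite eP adj_sym.
  by move=> u v; apply/idP/idP; exact: half.
have e_sub u v : e u v -> [/\ u \in f @: setT, v \in f @: setT & adj u v].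
  case/existsP=> x /existsP[y /and3P[xy /eqP-> /eqP->]].
  by split; rewrite ?imset_f //; apply: f_adj; rewrite ?inE.
pose K := @Subgraph U (f @: setT) e e_sym e_sub.
have fK x : f x \in sub_vert K by rewrite /= imset_f.
pose F (x : T) : graph_of K := exist _ (f x) (fK x).
have F_bij : bijective F.
  apply: inj_card_bij => [x y /(congr1 val) /= /inj_f //|].
  by rewrite /= card_sig /= card_imset // cardsT.
have [G FK GF] := F_bij.
exists K; exists G; split; first by exists F.
by move=> u v; rewrite -{2}(GF u) -{2}(GF v) /= /graph_of_adj /= eP.
Qed.

(** * Counting vertices and edges *)

Definition base_size (w : nat) : nat := `|Num.ceil (delta w)%R|%N.

Lemma Gstep0 w : Gstep w 0 = complete (base_size w).
Proof. by []. Qed.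

(** Adding [w.+1] turns the recursion a -> 2a + w + 1 into plain doubling. *)
Lemma card_Gstep (w k : nat) :
  #|Gstep w k| + w.+1 = 2 ^ k * (base_size w + w.+1).
Proof.
elim: k => [|k IH]; first by rewrite Gstep0 card_ord expn0 mul1n.
have -> : #|Gstep w k.+1| = w.+1 + (#|Gstep w k| + #|Gstep w k|).
  by rewrite /= !card_sum card_ord.
by rewrite expnS -mulnA -IH; lia.
Qed.

(** Every edge comes from an ordered pair in [r], and these pairs are counted by their second entry.
    Loops and non-edges in [r] do no harm. *)
Lemma card_edges_orientation (G : sgraph) (r : rel G) (d : nat) :
  (forall x y, adj x y -> r x y || r y x) ->
  (forall y, \sum_x (r x y : nat) <= d) -> #|edges G| <= #|G| * d.
Proof.
move=> adj_r indeg.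
pose E := [set q : G * G | r q.1 q.2].
have : #|edges G| <= #|E|.
  apply: leq_trans (leq_imset_card (fun q : G * G => [set q.1; q.2]) _).
  apply: subset_leq_card; apply/subsetP => e; rewrite inE.
  case/existsP=> x /existsP[y /andP[/adj_r/orP[xy|yx] /eqP->]].
    by apply/imsetP; exists (x, y); rewrite ?inE.
  by apply/imsetP; exists (y, x); rewrite ?inE //= setUC.
move/leq_trans; apply.
have -> : #|E| = \sum_y \sum_x (r x y : nat).
  rewrite exchange_big pair_big -sum1_card big_mkcond.
  by apply: eq_bigr => q _; rewrite inE; case: (r _ _).
by rewrite -sum_nat_const; apply: leq_sum => y _.
Qed.

(** Arcs leave the clique added at each level. A vertex thus receives at most [w.+1] arcs per level,
    and at most [base_size w] inside a base clique. *)
Lemma Gstep_orientation (w k : nat) : exists r : rel (Gstep w k),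
  (forall x y, adj x y -> r x y || r y x) /\
  (forall y, \sum_x (r x y : nat) <= w.+1 * k + base_size w).
Proof.
elim: k => [|k [r [adj_r indeg]]].
  rewrite Gstep0; exists (fun _ _ => true); split=> // y.
  by rewrite sum1_card card_ord muln0.
pose r' (u v : Gstep w k.+1) := match u, v with
  | inl _, _ => true
  | inr (inl x), inr (inl y) | inr (inr x), inr (inr y) => r x y
  | _, _ => false end.
exists r'; split=> [[x|[x|x]] [y|[y|y]] //=|y]; try exact: adj_r.
rewrite /= !big_sumType /= sum1_card card_ord mulnS -addnA leq_add2l.
case: y => [y|[y|y]] /=; rewrite !big1_eq ?addn0 ?add0n //.
Qed.

Lemma card_edges_Gstep (w k : nat) :
  #|edges (Gstep w k)| <= #|Gstep w k| * (w.+1 * k + base_size w).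
Proof.
have [r [adj_r indeg]] := Gstep_orientation w k.
exact: card_edges_orientation adj_r indeg.
Qed.

(** * Numerical estimates: the growth rate and the threshold [pw] *)

Lemma muln18_le_expn2 (p : nat) : 7 <= p -> 18 * p <= 2 ^ p.
Proof.
elim: p => // p IH; rewrite leq_eqVlt => /orP[/eqP<- //|p7].
by rewrite expnS; have := IH p7; lia.
Qed.

Local Open Scope ring_scope.

Lemma absz_ceil_itv (F : archiRealDomainType) (y : F) :
  0 <= y -> y <= `|Num.ceil y|%N%:R < y + 1.
Proof.
move=> y0; have /andP[lo hi] := ceil_itv y.
have -> : `|Num.ceil y|%N%:R = (Num.ceil y)%:~R :> F.
  by rewrite pmulrn gez0_abs // ceil_ge0; apply: lt_le_trans y0; rewrite oppr_lt0.
by rewrite hi andTb -ltrBlDr; move: lo; rewrite intrB.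
Qed.

Definition shrink (w : nat) : rat := (2 / 3) ^+ w.
(** The base of the power in [alpha], and the factor by which one level of splitting reduces a large
    forest. *)
Definition growth (w : nat) : rat := (2 + shrink w) / (1 + shrink w).

Lemma shrink_gt0 w : 0 < shrink w.
Proof. by apply: exprn_gt0; lra. Qed.

Lemma shrink_le1 w : shrink w <= 1.
Proof. by apply: exprn_ile1; lra. Qed.

Lemma betaE w : beta w = 3 / shrink w.
Proof. by rewrite /beta /shrink -exprVn invf_div. Qed.

Lemma beta_ge3 w : 3 <= beta w.
Proof.
rewrite betaE ler_pdivlMr ?shrink_gt0 //.
by have := shrink_le1 w; lra.
Qed.

Lemma deltaE w : delta w = (2 + shrink w) * beta w.
Proof. by []. Qed.

Lemma delta_ge6 w : 6 <= delta w.
Proof. by rewrite deltaE; have := beta_ge3 w; have := shrink_gt0 w; nra. Qed.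

Lemma base_size_itv w : delta w <= (base_size w)%:R < delta w + 1.
Proof. by apply: absz_ceil_itv; have := delta_ge6 w; lra. Qed.

Lemma base_size_gt0 w : (0 < base_size w)%N.
Proof.
have /andP[lo _] := base_size_itv w; have d6 := delta_ge6 w.
rewrite lt0n; apply/eqP => b0; rewrite b0 in lo.
by have := le_trans d6 lo.
Qed.

Lemma growth_gt0 w : 0 < growth w.
Proof. by rewrite divr_gt0 //; have := shrink_gt0 w; lra. Qed.

Lemma growth_le2 w : growth w <= 2.
Proof. by have x0 := shrink_gt0 w; rewrite /growth ler_pdivrMr; lra. Qed.

Lemma alphaS w p : alpha w p.+1 = (1 + shrink w)^-1 * growth w ^+ p.
Proof. by rewrite /alpha; have -> : p.+1%:Z - 1 = p by lia. Qed.

Lemma beta_le_alpha w p :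
  (beta w <= alpha w p.+1) = ((1 + shrink w) * beta w <= growth w ^+ p).
Proof. by rewrite alphaS mulrC ler_pdivlMr ?[_ * beta w]mulrC //; have := shrink_gt0 w; lra. Qed.

Lemma growth_pw_ge w : (1 + shrink w) * beta w <= growth w ^+ pw w.
Proof. by rewrite -beta_le_alpha /pw; case: ex_minnP. Qed.

Lemma pw_le w p : (1 + shrink w) * beta w <= growth w ^+ p -> (pw w <= p)%N.
Proof. by rewrite -beta_le_alpha /pw; case: ex_minnP => m _; apply. Qed.

Lemma growth_pw_le w : growth w ^+ pw w <= delta w.
Proof.
have x0 := shrink_gt0 w.
case E: (pw w) => [|q]; first by have := delta_ge6 w; rewrite expr0; lra.
have /negP : ~ (1 + shrink w) * beta w <= growth w ^+ q.
  by move/pw_le; rewrite E ltnn.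
rewrite -ltNge exprS /growth mulrAC ler_pdivrMr; last by lra.
by rewrite deltaE -mulrA [beta w * _]mulrC => /ltW; rewrite ler_pM2l //; lra.
Qed.

(** * Embedding forests in [Gstep] *)

Lemma balanced_size w (n a b : nat) : (2 <= w)%N ->
  (base_size w < n)%N -> (b <= a)%N -> (a + b <= n)%N ->
  (2 ^ w.+1 * (a - b) <= n \/ a - b <= 2)%N -> growth w * a%:R <= n%:R.
Proof.
move=> w2 n_large ba abn bal.
have x0 := shrink_gt0 w; have x1 := shrink_le1 w.
rewrite /growth mulrAC ler_pdivrMr; last by lra.
have {}abn : a%:R + b%:R <= n%:R :> rat by rewrite -natrD ler_nat.
(* This suffices because 2a <= n + (a - b). *)
suff d_le : (2 + shrink w) * (a - b)%:R <= n%:R * shrink w.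
  by move: d_le; rewrite natrB //; nra.
case: bal => [bal|d2].
- have {}bal : 2 * 2 ^+ w * (a - b)%:R <= n%:R :> rat.
    by rewrite -exprS -natrX -natrM ler_nat.
  (* With x = [shrink w], the bound (4/3)^w >= 16/9 gives n x >= (32/9)(a - b), and 32/9 exceeds 2 +
     x. *)
  have pw43 : 16 / 9 <= 2 ^+ w * shrink w.
    rewrite -exprMn; have -> : 16 / 9 = (2 * (2 / 3)) ^+ 2 :> rat by [].
    by apply: ler_weXn2l w2; lra.
  set u := 2 ^+ w in bal pw43.
  have : 2 * (u * shrink w) * (a - b)%:R <= n%:R * shrink w.
    by rewrite mulrA mulrAC ler_pM2r.
  have : 0 <= (a - b)%:R :> rat by [].
  by nra.
(* Here the choice of [delta] enters: n x >= [delta w] x = 3(2 + x), while a - b <= 2. *)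
- have {}n_large : delta w <= n%:R.
    have /andP[lo _] := base_size_itv w; apply: le_trans lo _.
    by rewrite ler_nat ltnW.
  have : 3 * (2 + shrink w) <= n%:R * shrink w.
    have : delta w * shrink w <= n%:R * shrink w by rewrite ler_pM2r.
    by rewrite deltaE betaE mulrA divfK ?gt_eqF // [_ * 3]mulrC.
  have : (a - b)%:R <= 2 :> rat by rewrite ler_nat.
  by nra.
Qed.

(** The induction runs over subsets of one fixed [T], so acyclicity needs no transfer to the parts.
    The first alternative covers forests too small for [balanced_size]. *)
Lemma embeds_Gstep (T : sgraph) (w k : nat) (U : {set T}) :
  acyclic T -> (2 <= w)%N ->
  (#|U| <= base_size w)%N \/ #|U|%:R <= growth w ^+ (k + pw w) ->
  embeds (Gstep w k) U.
Proof.
move=> acT w2; elim: k U => [|k IH] U U_small.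
  rewrite Gstep0; apply: embeds_complete; first exact: base_size_gt0.
  case: U_small => // U_small; have /andP[lo _] := base_size_itv w.
  have := le_trans U_small (le_trans (growth_pw_le w) lo).
  by rewrite ler_nat.
have glue A B : separated U A B -> (#|U :\: (A :|: B)| <= w.+1)%N ->
    embeds (Gstep w k) A -> embeds (Gstep w k) B -> embeds (Gstep w k.+1) U.
  move=> sepAB S_small embA embB.
  apply: (@embeds_join _ (complete w.+1) _ _ (A :|: B)).
    exact: embeds_complete.
  exact: embeds_disjoint_union sepAB embA embB.
have [U_base|U_large] := leqP #|U| (base_size w).
  (* A small forest goes whole into one copy, with nothing removed. *)
  apply: (@glue U set0).
  - split=> //; [exact: sub0set | by rewrite disjoints_subset setC0 subsetT|].
    by move=> x y _; rewrite inE.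
  - by rewrite setU0 setDv cards0.
  - by apply: IH; left.
  - by apply: IH; left; rewrite cards0.
case: U_small => [|U_small]; first by rewrite leqNgt U_large.
have [A [B [sepAB S_small BA bal]]] := acyclic_balanced_separator U w.+1 acT.
have [AU BU AB _] := sepAB.
have ABU : (#|A| + #|B| <= #|U|)%N.
  rewrite -cardsUI (disjoint_setI0 AB) cards0 addn0.
  by apply: subset_leq_card; rewrite subUset AU.
have A_small : #|A|%:R <= growth w ^+ (k + pw w).
  have := balanced_size w2 U_large BA ABU bal.
  move/le_trans => /(_ _ U_small); rewrite addSn exprS ler_pM2l //.
  exact: growth_gt0.
apply: (glue A B) => //; apply: IH; right => //.
by apply: le_trans A_small; rewrite ler_nat.
Qed.

(** * Powers of [growth] against powers of 2, and the order of [Gwp] *)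

(** With x = [shrink w], (2 + x)/(1 + x) >= 2(1 - x/2), and Bernoulli bounds (1 - x/2)^p below by 1
    - px/2 >= 1/2. *)
Lemma growth_expn_ge (w p : nat) :
  p%:R * shrink w <= 1 -> 2 ^+ p <= 2 * growth w ^+ p.
Proof.
move=> px; have x0 := shrink_gt0 w; have x1 := shrink_le1 w.
have g : 2 * (1 - shrink w / 2) <= growth w.
  by rewrite /growth ler_pdivlMr; nra.
have bernoulli m : 1 - m%:R * (shrink w / 2) <= (1 - shrink w / 2) ^+ m.
  elim: m => [|m IH]; first by rewrite mul0r subr0 expr0.
  have m0 : 0 <= m%:R :> rat by [].
  rewrite exprS; apply: le_trans (ler_wpM2l _ IH); last by lra.
  by rewrite -natr1; nra.
have : (2 * (1 - shrink w / 2)) ^+ p <= growth w ^+ p.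
  by apply: lerXn2r g; rewrite nnegrE; [lra | exact/ltW/growth_gt0].
rewrite exprMn => /(ler_wpM2l (ler0n _ 2)); apply: le_trans.
rewrite mulrCA ler_peMr ?exprn_ge0 //.
by have := bernoulli p; lra.
Qed.

Lemma beta_ge (w : nat) : w.+1%:R + 1 <= beta w.
Proof.
elim: w => [|w IH]; first by rewrite /beta expr0.
have -> : beta w.+1 = 3 / 2 * beta w by rewrite /beta exprS mulrCA.
by rewrite [w.+2%:R]mulrSr; move: IH; have := beta_ge3 w; lra.
Qed.

Lemma card_Gwp_le (w p : nat) : (pw w <= p)%N -> (#|Gwp w p| <= 3 * 2 ^ p)%N.
Proof.
move=> pwp; have x0 := shrink_gt0 w; have b3 := beta_ge3 w.
(* The left side is below (2 + x) [beta w] + w + 2 <= (3 + x) [beta w] by [beta_ge], hence below 3(1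
   + x) [beta w]. *)
have base : (base_size w + w.+1 <= 3 * 2 ^ pw w)%N.
  have /andP[_] := base_size_itv w; rewrite deltaE; move: (base_size w) => D hi.
  have bw := beta_ge w; rewrite -(ler_nat rat) natrD natrM natrX.
  have gpw : (1 + shrink w) * beta w <= 2 ^+ pw w.
    apply: le_trans (growth_pw_ge w) _.
    by apply: lerXn2r (growth_le2 w); rewrite nnegrE // ltW // growth_gt0.
  move: (2 ^+ pw w : rat) gpw => Q gpw.
  by nra.
have := card_Gstep w (p - pw w); rewrite -/(Gwp w p) => cG.
have -> : (2 ^ p = 2 ^ (p - pw w) * 2 ^ pw w)%N by rewrite -expnD subnK.
apply: leq_trans (leq_addr w.+1 _) _.
by rewrite cG mulnCA leq_mul2l base orbT.
Qed.

(** * Logarithms and the choice of p and w *)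

Section Logarithm.
Variables (R : realType) (b : R).
Hypothesis b_gt1 : 1 < b.

Let lnb_gt0 : 0 < ln b.
Proof. exact: ln_gt0. Qed.

Let b_gt0 : 0 < b.
Proof. exact: lt_trans ltr01 b_gt1. Qed.

Lemma logbX (m : nat) : logb b (b ^+ m) = m%:R.
Proof. by rewrite /logb lnXn // -[ln b *+ m]mulr_natl mulfK // gt_eqF. Qed.

Lemma logbb : logb b b = 1.
Proof. by have := logbX 1; rewrite expr1. Qed.

Lemma logbM (x y : R) : 0 < x -> 0 < y -> logb b (x * y) = logb b x + logb b y.
Proof. by move=> x0 y0; rewrite /logb lnM ?posrE // mulrDl. Qed.

Lemma ler_logb (x y : R) : 0 < x -> 0 < y -> (logb b x <= logb b y) = (x <= y).
Proof. by move=> x0 y0; rewrite /logb ler_pM2r ?invr_gt0 // ler_ln. Qed.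

Lemma logb_ge0 (x : R) : 1 <= x -> 0 <= logb b x.
Proof. by move=> x1; rewrite /logb divr_ge0 ?ln_ge0 // ltW. Qed.

(** Rounding up adds less than 1 to the exponent, so it costs a factor less than [b]. *)
Lemma expn_ceil_logb (x : R) : 1 <= x ->
  x <= b ^+ `|Num.ceil (logb b x)|%N < b * x.
Proof.
move=> x1; have x0 : 0 < x by exact: lt_le_trans x1.
have /andP[lo hi] := absz_ceil_itv (logb_ge0 x1).
set m := `|_|%N in lo hi *.
rewrite -ler_logb ?exprn_gt0 // logbX lo /= ltNge -ler_logb ?mulr_gt0 ?exprn_gt0 //.
by rewrite logbX logbM // logbb -ltNge addrC.
Qed.
End Logarithm.

Lemma p_of_bounds (R : realType) (n : nat) : (0 < n)%N ->
  (2 * n <= 2 ^ p_of R n < 4 * n)%N.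
Proof.
move=> n0.
have n1 : 1 <= n%:R :> R by rewrite ler1n.
have b1 : 1 < 2 :> R by lra.
have x1 : 1 <= 2 * n%:R :> R by lra.
have /andP[lo hi] := expn_ceil_logb b1 x1; rewrite -/(p_of R n) in lo hi.
rewrite -natrX in lo hi; move: (2 ^ p_of R n)%N lo hi => P lo hi.
by rewrite -(ler_nat R) -(ltr_nat R) !natrM lo; move: hi; lra.
Qed.

Lemma w_of_bounds (R : realType) (n : nat) : (0 < p_of R n)%N ->
  (p_of R n)%:R <= (3 / 2 : rat) ^+ w_of R n < 3 / 2 * (p_of R n)%:R.
Proof.
move=> p0.
have p1 : 1 <= (p_of R n)%:R :> R by rewrite ler1n.
have b1 : 1 < 3 / 2 :> R by lra.
have := expn_ceil_logb b1 p1; rewrite -/(w_of R n).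
(* The bounds pass from [R] to [rat], where [shrink] and [beta] live. *)
have -> : 3 / 2 = ratr (3 / 2)%R :> R by rewrite fmorph_div /= !ratr_nat.
have -> : (p_of R n)%:R = ratr (p_of R n)%:R :> R by rewrite ratr_nat.
by rewrite -rmorphXn -rmorphM /= ler_rat ltr_rat.
Qed.

Lemma p_of_le_logb (R : realType) (n : nat) : (0 < n)%N ->
  (p_of R n)%:R <= logb 2 n%:R + 2 :> R.
Proof.
move=> n0; have n1 : 1 <= n%:R :> R by rewrite ler1n.
have b1 : 1 < 2 :> R by lra.
have log0 : 0 <= logb 2 (2 * n%:R) :> R by apply: logb_ge0 => //; lra.
have /andP[_] := absz_ceil_itv log0; rewrite -/(p_of R n).
rewrite logbM //; last by lra.
by rewrite logbb //; lra.
Qed.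

Lemma w_of_le_logb (R : realType) (n : nat) : (0 < p_of R n)%N ->
  2 <= logb 2 n%:R :> R -> (0 < n)%N ->
  (w_of R n)%:R <= logb (3 / 2) (logb 2 n%:R) + 3 :> R.
Proof.
move=> p0 L2 n0; have p1 : 1 <= (p_of R n)%:R :> R by rewrite ler1n.
have b1 : 1 < 3 / 2 :> R by lra.
have /andP[_] := absz_ceil_itv (logb_ge0 b1 p1); rewrite -/(w_of R n).
have pL := p_of_le_logb R n0; set L := logb 2 n%:R in L2 pL *.
(* Since L >= 2, p <= L + 2 <= (9/4) L, which adds 2 to the logarithm; the rounding adds the third
   unit. *)
have sq : (3 / 2) ^+ 2 = 9 / 4 :> R by rewrite expr2; lra.
have : logb (3 / 2) (p_of R n)%:R <= logb (3 / 2) ((3 / 2) ^+ 2 * L).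
  by rewrite ler_logb ?sq; lra.
by rewrite logbM ?logbX // ?sq; lra.
Qed.

(** * The edge bound and the final assembly *)

Lemma card_edges_Gwp_le (w p n : nat) : (pw w <= p)%N ->
  (3 / 2 : rat) ^+ w < 3 / 2 * p%:R -> (2 ^ p < 4 * n)%N ->
  (#|edges (Gwp w p)| <= 12 * n * ((w + 16) * p))%N.
Proof.
move=> pwp w_hi p_hi.
have := card_edges_Gstep w (p - pw w); rewrite -/(Gwp w p) => /leq_trans; apply.
have V := card_Gwp_le pwp.
(* [delta w] <= 3 * 3 * (3/2) p = 13.5 p, and rounding adds less than 1 <= p. *)
have base : (base_size w <= 15 * p)%N.
  have /andP[_] := base_size_itv w; move: (base_size w) => D.
  rewrite deltaE /beta -(ler_nat rat) natrM => D_hi.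
  have x0 := shrink_gt0 w; have x1 := shrink_le1 w.
  have z0 : 0 < (3 / 2 : rat) ^+ w by apply: exprn_gt0; lra.
  have p1 : 1 <= p%:R :> rat.
    rewrite ler1n lt0n; apply/eqP => p0.
    by move: (lt_trans z0 w_hi); rewrite p0 mulr0 ltxx.
  move: ((3 / 2 : rat) ^+ w) (shrink w) x0 x1 w_hi z0 D_hi => z x x0 x1 w_hi z0 D_hi.
  by nra.
apply: leq_mul; first by lia.
apply: leq_trans (leq_add (leq_mul (leqnn w.+1) (leq_subr (pw w) p)) base) _.
by rewrite -mulnDl leq_mul2r addSn -addnS leqnn orbT.
Qed.

Theorem theorem3p11 (R : realType) :
  exists (C : R) (N : nat), forall n : nat, (N <= n)%N ->
    let p := p_of R n in
    let w := w_of R n in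
    [/\ (pw w <= p)%N,
        (#|Gwp w p| <= 20 * n)%N,
        #|edges (Gwp w p)|%:R
          <= 20 * n%:R * logb 2 n%:R * logb (3 / 2) (logb 2 n%:R)
             + C * (n%:R * ln n%:R)
      & forall T : sgraph, is_tree T -> #|T| = n -> contains (Gwp w p) T].
Proof.
(* 456 = 12 * 19 * 2 is the constant term of 12 (l + 19)(L + 2), and [ln 2] converts [logb 2] to
   [ln]. From n >= 128 follow p >= 7 and L >= 3. *)
exists (456 / ln 2), 128%N => n n_large p w.
have n0 : (0 < n)%N by exact: leq_trans n_large.
have /andP[p_lo p_hi] := p_of_bounds R n0; rewrite -/p in p_lo p_hi.
have b1 : 1 < 2 :> R by lra.
have n1 : 1 <= n%:R :> R by rewrite ler1n.
have L3 : 3 <= logb 2 n%:R :> R.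
  rewrite -(logbX b1 3) ler_logb ?exprn_gt0 //; last by lra.
  by rewrite -natrX ler_nat; apply: leq_trans n_large.
have pL := p_of_le_logb R n0; rewrite -/p in pL.
have p7 : (7 <= p)%N.
  rewrite leqNgt; apply/negP => p_lt7.
  have : (2 ^ p <= 2 ^ 7)%N by rewrite leq_exp2l // ltnW.
  by move: p_lo n_large; lia.
have p0 : (0 < p)%N by exact: leq_trans p7.
have /andP[w_lo w_hi] := w_of_bounds p0; rewrite -/p -/w in w_lo w_hi.
have wl : w%:R <= logb (3 / 2) (logb 2 n%:R) + 3 :> R.
  by apply: w_of_le_logb => //; lra.
clearbody w; clearbody p.
have p7' : 7 <= p%:R :> rat by rewrite ler_nat.
have w2 : (2 <= w)%N.
  rewrite leqNgt; apply/negP => w_lt2; move: w_lo.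
  by case: w w_lt2 {w_hi wl} => [|[|//]] _; rewrite ?expr0 ?expr1; lra.
have px : p%:R * shrink w <= 1.
  have -> : shrink w = ((3 / 2) ^+ w)^-1 by rewrite /shrink -exprVn invf_div.
  by rewrite ler_pdivrMr ?mul1r //; apply: exprn_gt0; lra.
have g_lo := growth_expn_ge px.
have pwp : (pw w <= p)%N.
  apply: pw_le; rewrite /beta.
  (* [(1 + shrink w) * beta w] is below 2 * 3 * (3/2) p = 9p, and 9p <= 2^p / 2 <=
     [growth w ^+ p]. *)
  have : 18 * p%:R <= 2 ^+ p :> rat.
    by rewrite -natrX -natrM ler_nat muln18_le_expn2.
  have x0 := shrink_gt0 w; have x1 := shrink_le1 w.
  move: (2 ^+ p : rat) (growth w ^+ p) g_lo => P G g_lo.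
  have z0 : 0 < (3 / 2 : rat) ^+ w by apply: exprn_gt0; lra.
  move: ((3 / 2 : rat) ^+ w) (shrink w) z0 w_hi x0 x1 => z x z0 w_hi x0 x1.
  by nra.
split=> //.
- by apply: leq_trans (card_Gwp_le pwp) _; clear -p_hi; lia.
- have l0 : 0 <= logb (3 / 2) (logb 2 n%:R) :> R by apply: logb_ge0; lra.
  have -> : 456 / ln 2 * (n%:R * ln n%:R) = 456 * n%:R * logb 2 n%:R :> R.
    by rewrite /logb; ring.
  have := card_edges_Gwp_le pwp w_hi p_hi.
  rewrite -(ler_nat R) !natrM natrD => /le_trans; apply.
  set L := logb 2 n%:R in L3 pL wl l0 *.
  set l := logb (3 / 2) L in wl l0 *.
  have wp : (w%:R + 16) * p%:R <= (l + 19) * (L + 2) :> R.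
    by apply: ler_pM => //; rewrite ?addr_ge0 //; lra.
  (* L >= 3 yields 24 l <= 8 L l and 228 L + 456 <= 456 L. *)
  have lL : 12 * ((l + 19) * (L + 2)) <= 20 * L * l + 456 * L by nra.
  have : n%:R * (12 * ((w%:R + 16) * p%:R)) <= n%:R * (20 * L * l + 456 * L) :> R.
    by rewrite ler_wpM2l //; lra.
  by lra.
- move=> T [_ acT] cardT; apply: embeds_contains.
  apply: embeds_Gstep => //; right; rewrite cardsT cardT subnK //.
  have : 2 * n%:R <= 2 ^+ p :> rat by rewrite -natrX -natrM ler_nat.
  move: (2 ^+ p : rat) (growth w ^+ p) g_lo => P G; lra.
Qed.
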